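(* Let $\mathbf\Omega,\mathbf\Gamma$ be symmetric positive definite $M\times M$ matrices with $\mathbf\Omega\succ\mathbf\Gamma$, and consider the scheme LAG-II with $\mathbf M=0$: $$\mathbf x^{k+1}=\arg\min_{\mathbf x}f(\mathbf x)+\tfrac12\big\|\mathbf A\mathbf x-\mathbf a^k+\mathbf\Gamma^{-1}\mathbf p^k\big\|_{\mathbf\Gamma}^2,\quad \mathbf p^{k+1}=\mathbf p^k+\mathbf\Gamma(\mathbf A\mathbf x^{k+1}-\mathbf a^k),\quad \mathbf a^{k+1}=\mathrm{prox}_g^{\mathbf\Omega}\big(\mathbf a^k+\mathbf\Omega^{-1}(2\mathbf p^{k+1}-\mathbf p^k)\big).$$ Then it can be expressed as the resolvent iteration $$\mathbf v^{k+1}=\big(\mathcal I+\mathcal D(\mathcal L+\mathcal K^\top\circ\partial f^*\circ\mathcal K)\mathcal D\big)^{-1}\mathbf v^k,$$ where $$\mathcal D=\begin{bmatrix}\mathbf\Omega&-\mathbf I_M\\-\mathbf I_M&\mathbf\Gamma^{-1}\end{bmatrix}^{-1/2},\quad\mathcal L=\begin{bmatrix}\partial g&-\mathbf I_M\\\mathbf I_M&0\end{bmatrix},\quad\mathcal K=\begin{bmatrix}0&-\mathbf A^\top\end{bmatrix},$$ and $\mathbf v$ is linked to $(\mathbf a,\mathbf p)$ in LAG-II via $$\mathbf v^k=\begin{bmatrix}\mathbf\Omega&-\mathbf I_M\\-\mathbf I_M&\mathbf\Gamma^{-1}\end{bmatrix}^{1/2}\begin{bmatrix}\mathbf a^k\\\mathbf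 p^k\end{bmatrix}\in\mathbb R^M\times\mathbb R^M .$$
   Context: $f:\mathbb R^N\to\mathbb R\cup\{+\infty\}$ and $g:\mathbb R^M\to\mathbb R\cup\{+\infty\}$ are proper, lower semicontinuous and convex; $\mathbf A:\mathbb R^N\to\mathbb R^M$ is linear; $f^*$ is the Fenchel conjugate of $f$. $\|\mathbf u\|_B^2=\langle\mathbf u,B\mathbf u\rangle$; $\mathrm{prox}_\varphi^B(\mathbf u)=\arg\min_{\mathbf w}\varphi(\mathbf w)+\frac12\|\mathbf w-\mathbf u\|_B^2$; $X\succ Y$ means $X-Y$ is symmetric positive definite. The iterates ($\arg\min$'s) are assumed to exist. $\mathcal L$ is the set-valued operator $\mathcal L(\mathbf a,\mathbf p)=(\partial g(\mathbf a)-\mathbf p)\times\{\mathbf a\}$ on $\mathbb R^M\times\mathbb R^M$; $\mathcal K:\mathbb R^M\times\mathbb R^M\to\mathbb R^N$, $\mathcal K(\mathbf a,\mathbf p)=-\mathbf A^\top\mathbf p$, so $\mathcal K^\top\mathbf x=(0,-\mathbf A\mathbf x)$; $\mathcal I$ is the identity. *)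

(* Defs.v *)
From HB Require Import structures.
From mathcomp Require Import all_boot all_order all_algebra.
From mathcomp Require Import all_classical all_reals all_analysis.

Set Implicit Arguments.
Unset Strict Implicit.
Unset Printing Implicit Defensive.
Import Order.TTheory GRing.Theory Num.Theory.
Import numFieldNormedType.Exports.
Local Open Scope classical_set_scope.
Local Open Scope ring_scope.

(* R^n is 'cV[R]_n, and R^m x R^m is 'cV[R]_(m + m) through col_mx, usubmx and
   dsubmx. A set-valued operator from R^n to R^m is a function
   'cV[R]_n -> set 'cV[R]_m. *)

Section Euclidean.
Variable R : realType.

Definition inner n (u v : 'cV[R]_n) : R := (u^T *m v) 0 0.

Definition sqnorm n (B : 'M[R]_n) (u : 'cV[R]_n) : R := inner u (B *m u).

Definition posdef n (B : 'M[R]_n) : Prop :=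
  B^T = B /\ forall u : 'cV[R]_n, u != 0 -> 0 < inner u (B *m u).

Definition possemidef n (B : 'M[R]_n) : Prop :=
  B^T = B /\ forall u : 'cV[R]_n, 0 <= inner u (B *m u).

(* The principal square root: a symmetric positive definite S has exactly one
   symmetric positive semidefinite square root. The value 0 is only returned
   when there is no such root. *)
Definition sqrtmx n (S : 'M[R]_n) : 'M[R]_n :=
  xget 0 [set Q : 'M[R]_n | possemidef Q /\ Q *m Q = S].

End Euclidean.

Section ConvexAnalysis.
Variables (R : realType) (n : nat).
Implicit Types (phi : 'cV[R]_n -> \bar R) (B : 'M[R]_n) (u x y : 'cV[R]_n).

(* The exclusion of -oo makes phi a function into R U {+oo}. *)
Definition proper phi : Prop :=
  (forall x, phi x <> -oo%E) /\ exists x, phi x <> +oo%E.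

(* For phi without value -oo the right-hand side is never oo - oo; at t = 0 and
   t = 1 it uses 0 * +oo = 0. *)
Definition econvex phi : Prop :=
  forall x y (t : R), 0 <= t <= 1 ->
    (phi (t *: x + (1 - t) *: y)%R
       <= t%:E * phi x + (1 - t)%R%:E * phi y)%E.

Definition proper_lsc_convex phi : Prop :=
  [/\ proper phi, lower_semicontinuous phi & econvex phi].

Definition fenchel phi : 'cV[R]_n -> \bar R :=
  fun u => ereal_sup [set ((inner u x)%:E - phi x)%E | x in setT].

Definition subdiff phi : 'cV[R]_n -> set 'cV[R]_n :=
  fun x => [set u | phi x \is a fin_num /\
    forall y, (phi x + (inner u (y - x)%R)%:E <= phi y)%E].

Definition argmin phi : set 'cV[R]_n :=
  [set w | forall z, (phi w <= phi z)%E].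

Definition prox B phi u : set 'cV[R]_n :=
  argmin (fun w => (phi w + (2^-1 * sqnorm B (w - u))%R%:E)%E).

End ConvexAnalysis.

Section Operators.
Variable R : realType.

Definition op_id n : 'cV[R]_n -> set 'cV[R]_n := fun z => [set z].

Definition op_add n m (S T : 'cV[R]_n -> set 'cV[R]_m) :
    'cV[R]_n -> set 'cV[R]_m :=
  fun z => [set s + t | s in S z & t in T z].

Definition op_inv n m (T : 'cV[R]_n -> set 'cV[R]_m) :
    'cV[R]_m -> set 'cV[R]_n :=
  fun v => [set z | T z v].

(* The composite B o T o C of T with two linear maps. *)
Definition op_comp n m p q (B : 'M[R]_(q, m))
    (T : 'cV[R]_n -> set 'cV[R]_m) (C : 'M[R]_(n, p)) :
    'cV[R]_p -> set 'cV[R]_q :=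
  fun z => [set B *m y | y in T (C *m z)].

End Operators.

Section Scheme.
Variables (R : realType) (n m : nat).
Variables (f : 'cV[R]_n -> \bar R) (g : 'cV[R]_m -> \bar R).
Variables (A : 'M[R]_(m, n)) (Omega Gamma : 'M[R]_m).

Definition x_objective (a p : 'cV[R]_m) : 'cV[R]_n -> \bar R :=
  fun x =>
    (f x + (2^-1 * sqnorm Gamma (A *m x - a + invmx Gamma *m p))%R%:E)%E.

(* The x-update need not have a unique minimizer, hence the membership; x 0 is
   irrelevant. *)
Definition LAG_II (x : nat -> 'cV[R]_n) (p a : nat -> 'cV[R]_m) : Prop :=
  forall k,
    [/\ argmin (x_objective (a k) (p k)) (x k.+1),
        p k.+1 = p k + Gamma *m (A *m x k.+1 - a k)
      & prox Omega g (a k + invmx Omega *m (2 *: p k.+1 - p k)) (a k.+1)].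

Definition metric : 'M[R]_(m + m) :=
  block_mx Omega (- 1%:M) (- 1%:M) (invmx Gamma).

Definition opD : 'M[R]_(m + m) := invmx (sqrtmx metric).

Definition opL : 'cV[R]_(m + m) -> set 'cV[R]_(m + m) :=
  fun z => [set col_mx (u - dsubmx z) (usubmx z) | u in subdiff g (usubmx z)].

Definition opK : 'M[R]_(n, m + m) := row_mx 0 (- A^T).

Definition resolvent : 'cV[R]_(m + m) -> set 'cV[R]_(m + m) :=
  op_inv
    (op_add (@op_id R (m + m))
      (op_comp opD
         (op_add opL (op_comp opK^T (subdiff (fenchel f)) opK))
         opD)).

End Scheme.

(* Main.v *)
Require Import Defs.
From HB Require Import structures.
From mathcomp Require Import all_boot all_order all_algebra.
From mathcomp Require Import all_classical all_reals all_analysis.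
From mathcomp Require Import complex ring lra.

Set Implicit Arguments.
Unset Strict Implicit.
Unset Printing Implicit Defensive.
Import Order.TTheory GRing.Theory Num.Theory.
Import numFieldNormedType.Exports.
Local Open Scope classical_set_scope.
Local Open Scope ring_scope.

(* Write z = (a, p), P for the metric and T for L + K^T o df^* o K. Applying
   P^(1/2) shows that the resolvent inclusion from z to z' is
   P (z - z') \in T z', whose first block is the optimality condition of the
   prox-step for a' and whose second block reads p' = p + Gamma (A x - a) for
   some x in df^*(- A^T p'). Optimality of an x-update gives
   - A^T p' \in df(x), hence x \in df^*(- A^T p'). The reverse implication is
   not needed: as df^* is monotone, p' is determined by (a, p), so it is the
   one produced by any minimizer of the x-update. *)

(** * The inner product and positive definite matrices *)

Section PositiveMatrices.
Variable R : realType.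

Lemma innerDl n (u v w : 'cV[R]_n) : inner (u + v) w = inner u w + inner v w.
Proof. by rewrite /inner linearD mulmxDl mxE. Qed.

Lemma innerNl n (u v : 'cV[R]_n) : inner (- u) v = - inner u v.
Proof. by rewrite /inner linearN mulNmx mxE. Qed.

Lemma innerC n (u v : 'cV[R]_n) : inner u v = inner v u.
Proof. by rewrite /inner -[v^T *m u]trmxK [RHS]mxE trmx_mul trmxK. Qed.

Lemma innerDr n (u v w : 'cV[R]_n) : inner u (v + w) = inner u v + inner u w.
Proof. by rewrite innerC innerDl !(innerC _ u). Qed.

Lemma innerNr n (u v : 'cV[R]_n) : inner u (- v) = - inner u v.
Proof. by rewrite innerC innerNl innerC. Qed.

Lemma innerZr n c (u v : 'cV[R]_n) : inner u (c *: v) = c * inner u v.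
Proof. by rewrite /inner -scalemxAr mxE. Qed.

Lemma innerZl n c (u v : 'cV[R]_n) : inner (c *: u) v = c * inner u v.
Proof. by rewrite innerC innerZr innerC. Qed.

Lemma inner_mull n k (M : 'M[R]_(n, k)) u v :
  inner (M *m u) v = inner u (M^T *m v).
Proof. by rewrite /inner trmx_mul mulmxA. Qed.

Lemma inner_ge0 n (u : 'cV[R]_n) : 0 <= inner u u.
Proof.
by rewrite /inner mxE sumr_ge0 // => i _; rewrite mxE -expr2 sqr_ge0.
Qed.

Lemma inner_gt0 n (u : 'cV[R]_n) : u != 0 -> 0 < inner u u.
Proof.
move=> u0; rewrite lt0r inner_ge0 andbT /inner mxE; apply: contraNneq u0.
move=> /eqP; rewrite psumr_eq0; last by move=> i _; rewrite mxE -expr2 sqr_ge0.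
move=> /allP u0; apply/eqP/colP => i.
have := u0 i (mem_index_enum i).
by rewrite /= !mxE mulf_eq0 orbb => /eqP.
Qed.

Lemma inner_col_mx n k (u u' : 'cV[R]_n) (v v' : 'cV[R]_k) :
  inner (col_mx u v) (col_mx u' v') = inner u u' + inner v v'.
Proof. by rewrite /inner tr_col_mx mul_row_col mxE. Qed.

Lemma posdef_semidef n (S : 'M[R]_n) : posdef S -> possemidef S.
Proof.
move=> [ST S0]; split=> // u; have [->|/S0/ltW//] := eqVneq u 0.
by rewrite mulmx0 /inner mulmx0 mxE.
Qed.

Lemma posdef_eq0 n (S : 'M[R]_n) u :
  posdef S -> inner u (S *m u) <= 0 -> u = 0.
Proof.
move=> [_ S0]; have [//|/S0 + ] := eqVneq u 0.
by rewrite ltNge => /negbTE ->.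
Qed.

(** The quadratic form vanishes on the transpose of every row of the left kernel, so that kernel is
    zero. *)
Lemma posdef_unitmx n (S : 'M[R]_n) : posdef S -> S \in unitmx.
Proof.
move=> S0; rewrite -row_free_unit -kermx_eq0; apply/eqP/row_matrixP => i.
rewrite row0; apply: trmx_inj; rewrite trmx0.
apply: (posdef_eq0 S0); rewrite /inner trmxK mulmxA -row_mul mulmx_ker row0.
by rewrite mul0mx mxE.
Qed.

(** * Square roots through the spectral theorem *)

Lemma polynomial_interpolation (F : fieldType) (h : F -> F) (s : seq F) :
  exists q : {poly F}, {in s, forall x, q.[x] = h x}.
Proof.
elim: s => [|a s [q qs]]; first by exists 0.
have [as_|as_] := boolP (a \in s).
  by exists q => x; rewrite inE => /predU1P[->|]; apply: qs.
(* Newton's step: [r] vanishes on [s] but not at [a], so adding a multiple of it corrects the value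
   at [a] and keeps those on [s]. *)
pose r := \prod_(b <- s) ('X - b%:P).
have ra : r.[a] != 0 by rewrite -rootE root_prod_XsubC.
exists (q + ((h a - q.[a]) / r.[a]) *: r) => x.
rewrite hornerD hornerZ inE => /predU1P[->|xs]; first by rewrite divfK ?subrKC.
have /eqP -> : r.[x] == 0 by rewrite -rootE root_prod_XsubC.
by rewrite mulr0 addr0 qs.
Qed.

Lemma trmx_horner n (S : 'M[R]_n.+1) q : (horner_mx S q)^T = horner_mx S^T q.
Proof.
elim/poly_ind: q => [|q c IHq]; first by rewrite !rmorph0 trmx0.
rewrite !rmorphD !rmorphM/= linearD/= !horner_mx_X !horner_mx_C tr_scalar_mx.
rewrite -[_ * S]/(_ *m S) trmx_mul IHq; congr (_ + _).
exact/esym/comm_horner_mx/comm_mx_refl.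
Qed.

Lemma eigenvalue_ge0 n (S : 'M[R]_n) l :
  possemidef S -> eigenvalue S l -> 0 <= l.
Proof.
move=> [ST S0] /eigenvalueP[u uS u0]; have := S0 u^T.
rewrite -[S]ST -trmx_mul uS linearZ innerZr pmulr_lge0 //.
by rewrite inner_gt0 // trmx_eq0.
Qed.

(** The spectral theorem is applied to the complexification of [S], which is Hermitian. Its
    eigenvalues are real, so they are eigenvalues of [S] over [R], where [eigenvalue_ge0]
    applies. *)
Lemma possemidef_diagonalization n (S : 'M[R]_n) : possemidef S ->
  exists (P : 'M[R[i]]_n) (d : 'rV[R]_n),
    [/\ P \in unitmx,
        P *m map_mx (real_complex R) S
          = diag_mx (map_mx (real_complex R) d) *m P
      & forall i, 0 <= d 0 i].
Proof.
move=> S0; have [ST _] := S0; set Sc := map_mx _ S.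
have Sh : Sc \is hermsymmx.
  apply: realsym_hermsym.
    apply/is_hermitianmxP; rewrite expr0 scale1r.
    by apply/matrixP=> i j; rewrite !mxE -{1}ST mxE.
  by apply/mxOverP => i j; rewrite mxE; apply/complex_realP; exists (S i j).
have /orthomx_spectralP := hermitian_normalmx Sh.
have := hermitian_spectral_diag_real Sh; have := spectral_unit Sc.
move: (spectralmx Sc) (spectral_diag Sc) => P d Pu /mxOverP dR SE.
have PS : P *m Sc = diag_mx d *m P by rewrite SE -mulmxA (mulKVmx Pu).
have dE : map_mx (real_complex R) (map_mx (@complex.Re R) d) = d.
  by apply/rowP => i; rewrite !mxE; have /complex_realP[l ->] := dR 0 i.
exists P, (map_mx (@complex.Re R) d); split; rewrite ?dE // => i.
apply: (eigenvalue_ge0 S0); rewrite -(eigenvalue_map (real_complex R)).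
rewrite [X in eigenvalue _ X](_ : _ = d 0 i); last first.
  by have /rowP/(_ i) := dE; rewrite mxE.
apply/eigenvalueP; exists (row i P).
  by rewrite -row_mul PS row_mul row_diag_mx -scalemxAl -rowE.
apply/eqP => Pi0; have : row i 1%:M = 0 :> 'rV[R[i]]_n.
  by rewrite -(mulmxV Pu) row_mul Pi0 mul0mx.
by move=> /rowP/(_ i); rewrite !mxE eqxx => /eqP; rewrite oner_eq0.
Qed.

(* With q interpolating the fourth root on the spectrum of S, the root is
   q(S)^2: it is real and symmetric as a real polynomial in S, and positive as
   the square of the symmetric matrix q(S). *)
Lemma possemidef_sqrt n (S : 'M[R]_n) :
  possemidef S -> exists Q, possemidef Q /\ Q *m Q = S.
Proof.
case: n S => [|n] S S0; first by exists S; split; rewrite // !thinmx0.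
have [ST _] := S0; have [P [d [Pu PS d0]]] := possemidef_diagonalization S0.
have [q qE] := polynomial_interpolation (fun x => Num.sqrt (Num.sqrt x))
  [seq d 0 i | i : 'I_n.+1].
have [H [HT HE]] : exists H : 'M[R]_n.+1, H^T = H /\
    P *m map_mx (real_complex R) H
      = diag_mx (map_mx (real_complex R) (map_mx (horner q) d)) *m P.
  exists (horner_mx S q); split; first by rewrite trmx_horner ST.
  rewrite map_horner_mx.
  have -> : map_mx (real_complex R) S
      = invmx P *m diag_mx (map_mx (real_complex R) d) *m P.
    by rewrite -mulmxA -PS mulKmx.
  rewrite horner_mx_uconjC // horner_mx_diag mulmxA (mulmxA P) mulmxV // mul1mx.
  by congr (diag_mx _ *m _); apply/rowP => i; rewrite !mxE horner_map.
exists (H *m H); split.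
  split; first by rewrite trmx_mul HT.
  by move=> u; rewrite -mulmxA -{1}HT -inner_mull inner_ge0.
(* After complexification and left multiplication by [P], the claim that the fourth power of [H] is
   [S] becomes an identity between diagonal matrices. *)
apply: (map_mx_inj (f := real_complex R)).
apply: (can_inj (mulKmx Pu)).
rewrite PS !map_mxM !mulmxA HE.
move: HE; set D := diag_mx (map_mx _ (map_mx _ _)); set Hc := map_mx _ H => HE.
have HD X : X *m P *m Hc = X *m D *m P by rewrite -!mulmxA HE.
rewrite !HD; congr (_ *m _); rewrite !mulmx_diag; congr diag_mx.
apply/rowP => i; rewrite !mxE qE ?map_f ?mem_enum // -!rmorphM/=; congr _%:C%C.
by rewrite -mulrA -!expr2 !sqr_sqrtr ?sqrtr_ge0.
Qed.

(** Existence of a root ensures that [xget] does not fall back on its default value 0. *)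
Lemma sqrtmxP n (S : 'M[R]_n) :
  possemidef S -> possemidef (sqrtmx S) /\ sqrtmx S *m sqrtmx S = S.
Proof.
move=> /possemidef_sqrt.
exact: (@xgetPex _ 0 [set Q : 'M[R]_n | possemidef Q /\ Q *m Q = S]).
Qed.

Lemma sqrtmx_unit n (S : 'M[R]_n) :
  posdef S -> sqrtmx S *m sqrtmx S = S /\ sqrtmx S \in unitmx.
Proof.
move=> S0; have [_ QQ] := sqrtmxP (posdef_semidef S0); split=> //.
by have := posdef_unitmx S0; rewrite -{1}QQ unitmx_mul andbb.
Qed.

(** Completing the square with [w = invmx Gamma *m p] splits the form at (a, p) into the form of
    [Omega - Gamma] at [a] plus that of [Gamma] at [a - w]. *)
Lemma posdef_metric n (Omega Gamma : 'M[R]_n) :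
  posdef Gamma -> posdef (Omega - Gamma) -> posdef (metric Omega Gamma).
Proof.
move=> G0 OG0; have Gu := posdef_unitmx G0; have GT : Gamma^T = Gamma := G0.1.
have OT : Omega^T = Omega.
  by rewrite -(subrK Gamma Omega) linearD /= (proj1 OG0) GT.
split.
  by rewrite /metric tr_block_mx OT trmx_inv GT !linearN /= !trmx1.
move=> z z0; rewrite -(vsubmxK z); set a := usubmx z; set p := dsubmx z.
pose w := invmx Gamma *m p; have pE : p = Gamma *m w by rewrite mulKVmx.
have -> : inner (col_mx a p) (metric Omega Gamma *m col_mx a p)
    = inner a ((Omega - Gamma) *m a) + inner (a - w) (Gamma *m (a - w)).
  rewrite mul_block_col inner_col_mx !mulNmx !mul1mx -/w mulmxBl mulmxBr.
  rewrite !(innerDl, innerDr, innerNl, innerNr) -!pE.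
  have -> : inner w (Gamma *m a) = inner a p.
    by rewrite pE -{1}GT -inner_mull innerC.
  rewrite (innerC p a) (innerC p w); ring.
(* Strict positivity comes from the second term when [a = 0], since then [w] is nonzero, and from
   the first term otherwise. *)
have [a0|a0] := eqVneq a 0.
  rewrite a0 mulmx0 sub0r {1}/inner mulmx0 mxE add0r.
  apply: G0.2; rewrite oppr_eq0; apply: contraNneq z0 => w0.
  by rewrite -(vsubmxK z) -/a -/p a0 pE w0 mulmx0 col_mx0.
by rewrite ltr_wpDr ?(proj2 OG0) // (proj2 (posdef_semidef G0)).
Qed.

End PositiveMatrices.

(** * Subdifferentials, conjugates and quadratic perturbations *)

Section Subdifferential.
Variables (R : realType) (n : nat).
Implicit Types (phi : 'cV[R]_n -> \bar R).

Lemma subdiff_monotone phi x y u v : subdiff phi x u -> subdiff phi y v ->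
  0 <= inner (u - v) (x - y).
Proof.
move=> [fx hu] [fy hv]; have := hu y; have := hv x.
rewrite -(fineK fx) -(fineK fy) -!EFinD !lee_fin.
rewrite !(innerDl, innerDr, innerNl, innerNr); lra.
Qed.

(** By the subgradient inequality the supremum defining [fenchel phi u] is attained at [x]. At any
    other [z], the term of index [x] bounds [fenchel phi z] from below. *)
Lemma subdiff_fenchel phi x u : subdiff phi x u -> subdiff (fenchel phi) u x.
Proof.
move=> [fx hu].
have le z : ((inner z x)%:E - phi x <= fenchel phi z)%E.
  by apply: ereal_sup_ubound; exists x.
have E : fenchel phi u = ((inner u x)%:E - phi x)%E.
  apply/eqP; rewrite eq_le le andbT; apply: ge_ereal_sup => _ [y _ <-].
  have := hu y; rewrite -(fineK fx); case: (phi y) => [r||] //=.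
    rewrite -!EFinD !lee_fin innerDr innerNr; lra.
  by rewrite leNye.
split; first by rewrite E -(fineK fx) -EFinN -EFinD.
move=> z; apply: le_trans (le z); rewrite E -(fineK fx) -EFinN -!EFinD lee_fin.
by rewrite innerDr innerNr (innerC x z) (innerC x u); lra.
Qed.

Lemma first_order_ge0 (s q : R) :
  (forall t, 0 < t <= 1 -> 0 <= t * s + t ^+ 2 * q) -> 0 <= s.
Proof.
move=> h; rewrite leNgt; apply/negP => s0.
have c0 : 0 < - s + `|q| + 1 by have := normr_ge0 q; lra.
(* With this choice [s + t * |q| = - t * (1 - s)], which is negative when [s < 0]. *)
pose t := - s / (- s + `|q| + 1).
have t0 : 0 < t by rewrite divr_gt0 // oppr_gt0.
have t1 : t <= 1 by rewrite ler_pdivrMr // mul1r; have := normr_ge0 q; lra.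
have := h t; rewrite t0 t1 expr2 -mulrA -mulrDr pmulr_rge0 // => /(_ isT).
apply/negP; rewrite -ltNge.
have tE : t * (- s + `|q| + 1) = - s by rewrite divfK // gt_eqF.
have : t * q <= t * `|q| by rewrite ler_wpM2l ?ler_norm // ltW.
have : 0 < t * (1 - s) by rewrite mulr_gt0 //; lra.
by move: tE; lra.
Qed.

Lemma argmin_fin_num phi (h : 'cV[R]_n -> R) w : Defs.proper phi ->
  argmin (fun x => phi x + (h x)%:E)%E w -> phi w \is a fin_num.
Proof.
move=> [nN [x xf]] /(_ x); move: xf (nN x) (nN w).
by case: (phi x) => // r _ _; case: (phi w).
Qed.

Variables (k : nat) (B : 'M[R]_k) (C : 'M[R]_(k, n)) (c : 'cV[R]_k).
Hypothesis B0 : possemidef B.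
(** This form covers both updates: [C = A] and [B = Gamma] for the x-update, [C = 1] and [B = Omega]
    for the prox. *)
Let h x := 2^-1 * sqnorm B (C *m x + c).
Let grad w := C^T *m (B *m (C *m w + c)).

Let hE (w d : 'cV[R]_n) :
  h (w + d) = h w + inner (grad w) d + 2^-1 * sqnorm B (C *m d).
Proof.
have -> : h (w + d) = 2^-1 * sqnorm B (C *m w + c + C *m d).
  by rewrite /h mulmxDr addrAC.
rewrite /h /grad /sqnorm [inner (C^T *m _) _]inner_mull trmxK.
move: (C *m w + c) (C *m d) => y e; rewrite mulmxDr !(innerDl, innerDr).
have -> : inner e (B *m y) = inner (B *m y) e by rewrite innerC.
have -> : inner y (B *m e) = inner (B *m y) e by rewrite inner_mull (proj1 B0).
lra.
Qed.

(** Minimality is tested at [w + t *: (y - w)]. Convexity bounds the change of [phi] linearly in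
    [t], and [hE] gives that of [h] exactly, so [first_order_ge0] extracts the subgradient
    inequality at [y]. *)
Lemma argmin_quadratic_subdiff phi w : Defs.proper phi -> econvex phi ->
  argmin (fun x => phi x + (h x)%:E)%E w -> subdiff phi w (- grad w).
Proof.
move=> phip cvx wmin; have fw := argmin_fin_num phip wmin; split=> // y.
have := phip.1 y; have := cvx y w; have := wmin.
rewrite -(fineK fw); case: (phi y) => [r||] // {}wmin {}cvx _;
  last by rewrite leey.
rewrite -EFinD lee_fin innerNl.
suff: 0 <= r - fine (phi w) + inner (grad w) (y - w) by lra.
apply: (@first_order_ge0 _ (2^-1 * sqnorm B (C *m (y - w)))) => t /andP[t0 t1].
have := cvx t; rewrite (ltW t0) t1 => /(_ isT).
have := wmin (t *: y + (1 - t) *: w).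
have -> : t *: y + (1 - t) *: w = w + t *: (y - w).
  by rewrite scalerBl scale1r scalerBr addrCA addrA.
rewrite hE innerZr -scalemxAr /sqnorm -scalemxAr innerZl innerZr.
rewrite -!EFinM -EFinD; have := proj1 phip (w + t *: (y - w)).
case: (phi (w + _)) => [r'||] // _.
rewrite -{1}(fineK fw) -!EFinD !lee_fin; nra.
Qed.

(** The linear term of [hE] cancels against the subgradient inequality, and the quadratic remainder
    is nonnegative. *)
Lemma subdiff_argmin_quadratic phi w : subdiff phi w (- grad w) ->
  argmin (fun x => phi x + (h x)%:E)%E w.
Proof.
move=> [fw hw] z; have zE := hE w (z - w); rewrite subrKC in zE.
have := hw z; rewrite zE.
have := B0.2 (C *m (z - w)); rewrite /sqnorm innerNl -(fineK fw).
case: (phi z) => [r||] // q0; rewrite -!EFinD ?lee_fin ?leey //; lra.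
Qed.

End Subdifferential.

(** * One step of the scheme and one step of the resolvent *)

Section LagrangianStep.
Variables (R : realType) (n m : nat).
Variables (f : 'cV[R]_n -> \bar R) (g : 'cV[R]_m -> \bar R).
Variables (A : 'M[R]_(m, n)) (Omega Gamma : 'M[R]_m).
Hypotheses (hf : proper_lsc_convex f) (hg : proper_lsc_convex g).
Hypotheses (hOmega : posdef Omega) (hGamma : posdef Gamma).
Hypothesis hOmegaGamma : posdef (Omega - Gamma).

(** A relaxed x-update: the minimizer is replaced by any point of df^* at [- A^T *m p'], which makes
    the update of [p] implicit. *)
Definition dual_step (a p p' : 'cV[R]_m) : Prop :=
  exists2 x, subdiff (fenchel f) (- A^T *m p') x &
    p' = p + Gamma *m (A *m x - a).

Definition primal_step (a p p' a' : 'cV[R]_m) : Prop :=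
  subdiff g a' (Omega *m (a - a') + 2 *: p' - p).

Lemma resolventP a p a' p' :
  resolvent f g A Omega Gamma
    (sqrtmx (metric Omega Gamma) *m col_mx a p)
    (sqrtmx (metric Omega Gamma) *m col_mx a' p') <->
  primal_step a p p' a' /\ dual_step a p p'.
Proof.
have [QQ Qu] := sqrtmx_unit (posdef_metric hGamma hOmegaGamma).
have Gu := posdef_unitmx hGamma.
have MzE : metric Omega Gamma *m (col_mx a p - col_mx a' p')
    = col_mx (Omega *m (a - a') - (p - p'))
        (invmx Gamma *m (p - p') - (a - a')).
  rewrite opp_col_mx add_col_mx mul_block_col !mulNmx !mul1mx.
  by rewrite [in RHS](addrC (invmx Gamma *m _)).
have KxE x : (opK A)^T *m x = col_mx 0 (- (A *m x)).
  by rewrite /opK tr_row_mx linear0 linearN /= trmxK mul_col_mx mul0mx mulNmx.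
have KzE : opK A *m col_mx a' p' = - A^T *m p'.
  by rewrite mul_row_col mul0mx add0r.
rewrite /resolvent /op_inv /op_add /op_comp /opD /op_id /opL /=.
set Q := sqrtmx _ in QQ Qu *; rewrite mulKmx // KzE col_mxKu col_mxKd.
split.
  move=> [_ -> [_ [_ [_ [u ua' <-] [_ [x xp <-] <-] <-]]] E].
  (* Multiplying the inclusion by [Q] turns [Q *m Q] into the metric and cancels [opD]. *)
  have {E} : col_mx (u - p') a' + (opK A)^T *m x
      = metric Omega Gamma *m (col_mx a p - col_mx a' p').
    rewrite -QQ -mulmxA mulmxBr -E.
    by rewrite [Q *m col_mx a' p' + _]addrC addrK mulKVmx.
  rewrite MzE KxE add_col_mx addr0 => /eq_col_mx[uE pE]; split.
    rewrite /primal_step -[X in subdiff g a' X](_ : u = _) //.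
    rewrite -(subrK p' u) uE; move: (Omega *m _) => w.
    by apply/colP => i; rewrite !mxE; ring.
  (* In the second block [a'] occurs on both sides and drops out. *)
  exists x => //; have -> : A *m x - a = invmx Gamma *m (p' - p).
    rewrite -[p' - p]opprB mulmxN.
    move: (A *m x) (invmx Gamma *m _) pE => w w' pE.
    by apply/colP => i; move/colP/(_ i): pE; rewrite !mxE; lra.
  by rewrite mulKVmx // addrC subrK.
move=> [ua' [x xp pE]].
exists (Q *m col_mx a' p') => //.
exists (invmx Q *m (metric Omega Gamma *m (col_mx a p - col_mx a' p')));
  last first.
  by rewrite -QQ -mulmxA mulKmx // mulmxBr addrC subrK.
exists (metric Omega Gamma *m (col_mx a p - col_mx a' p')) => //.
(* The value of [opL] is built from the subgradient given by [primal_step], shifted by [- p']. *)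
exists (col_mx (Omega *m (a - a') + 2 *: p' - p - p') a').
  by eexists; first exact: ua'.
exists ((opK A)^T *m x); first by exists x.
rewrite MzE KxE add_col_mx addr0.
have -> : invmx Gamma *m (p - p') = a - A *m x.
  by rewrite pE opprD addNKr -mulmxN mulKmx // opprB.
move: (A *m x) (Omega *m _) => w w'.
by congr col_mx; apply/colP => i; rewrite !mxE; ring.
Qed.

(** Monotonicity of df^* makes the [Gamma]-form of [A *m (x1 - x2)] nonpositive. Hence
    [A *m x1 = A *m x2], even if [x1] and [x2] differ, and only these images enter the update of
    [p]. *)
Lemma dual_step_unique a p p1 p2 :
  dual_step a p p1 -> dual_step a p p2 -> p1 = p2.
Proof.
move=> [x1 h1 E1] [x2 h2 E2]; have := subdiff_monotone h1 h2.
have pE : p1 - p2 = Gamma *m (A *m (x1 - x2)).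
  rewrite E1 E2 !mulmxBr; move: (Gamma *m _) (Gamma *m _) (Gamma *m _) => u v w.
  by apply/colP => i; rewrite !mxE; ring.
rewrite -mulmxBr mulNmx innerNr innerC inner_mull trmxK pE oppr_ge0 innerC.
move=> /(posdef_eq0 hGamma) Ax0.
by apply/eqP; rewrite -subr_eq0 pE Ax0 mulmx0.
Qed.

(** The two subgradients differ by [- (Omega *m (a1 - a2))], so monotonicity of dg forces
    [a1 = a2]. *)
Lemma primal_step_unique a p p' a1 a2 :
  primal_step a p p' a1 -> primal_step a p p' a2 -> a1 = a2.
Proof.
move=> h1 h2; have := subdiff_monotone h1 h2; set w := _ - (_ - p).
have -> : w = - (Omega *m (a1 - a2)).
  rewrite /w !mulmxBr; move: (Omega *m _) (Omega *m _) (Omega *m _) => u v t.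
  by apply/colP => i; rewrite !mxE; ring.
rewrite innerNl oppr_ge0 innerC => /(posdef_eq0 hOmega)/eqP.
by rewrite subr_eq0 => /eqP.
Qed.

Lemma x_update_dual_step a p x : argmin (x_objective f A Gamma a p) x ->
  dual_step a p (p + Gamma *m (A *m x - a)).
Proof.
have [fp _ fc] := hf => xmin; exists x => //; apply: subdiff_fenchel.
(* The gradient of the quadratic term at [x] is [A^T] applied to the updated multiplier. *)
have -> : - A^T *m (p + Gamma *m (A *m x - a))
    = - (A^T *m (Gamma *m (A *m x + (- a + invmx Gamma *m p)))).
  rewrite mulNmx addrA [Gamma *m (_ + invmx _ *m _)]mulmxDr.
  by rewrite mulKVmx ?posdef_unitmx // [p + _]addrC.
apply: (argmin_quadratic_subdiff (posdef_semidef hGamma)) => // z.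
by rewrite !addrA; exact: xmin.
Qed.

Lemma proxP a p p' a' :
  prox Omega g (a + invmx Omega *m (2 *: p' - p)) a' <-> primal_step a p p' a'.
Proof.
have [gp _ gc] := hg; rewrite /prox /primal_step.
set u := a + _.
have -> : Omega *m (a - a') + 2 *: p' - p
    = - (1%:M^T *m (Omega *m (1%:M *m a' - u))).
  rewrite -addrA /u; move: (2 *: p' - p) => e.
  rewrite trmx1 !mul1mx !mulmxBr mulmxDr mulKVmx ?posdef_unitmx //.
  move: (Omega *m _) (Omega *m _) => w w'.
  by apply/colP => i; rewrite !mxE; ring.
split=> [amin|h].
  apply: (argmin_quadratic_subdiff (posdef_semidef hOmega)) => // z.
  by rewrite !mul1mx; exact: amin.
move=> z; have := subdiff_argmin_quadratic (posdef_semidef hOmega) h z.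
by rewrite !mul1mx.
Qed.

End LagrangianStep.

(** * From single steps to whole sequences *)

Theorem proposition3 (R : realType) (n m : nat)
    (f : 'cV[R]_n -> \bar R) (g : 'cV[R]_m -> \bar R)
    (A : 'M[R]_(m, n)) (Omega Gamma : 'M[R]_m)
    (hf : proper_lsc_convex f) (hg : proper_lsc_convex g)
    (hOmega : posdef Omega) (hGamma : posdef Gamma)
    (hOmegaGamma : posdef (Omega - Gamma))
    (a p : nat -> 'cV[R]_m) (v : nat -> 'cV[R]_(m + m))
    (hx : forall k, argmin (x_objective f A Gamma (a k) (p k)) !=set0)
    (hv : forall k, v k = sqrtmx (metric Omega Gamma) *m col_mx (a k) (p k)) :
  (exists x : nat -> 'cV[R]_n, LAG_II f g A Omega Gamma x p a) <->
  (forall k, resolvent f g A Omega Gamma (v k) = [set v k.+1]).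
Proof.
have step k : resolvent f g A Omega Gamma (v k) (v k.+1) <->
    primal_step g Omega (a k) (p k) (p k.+1) (a k.+1)
    /\ dual_step f A Gamma (a k) (p k) (p k.+1).
  by rewrite !hv; exact: resolventP.
split=> [[x hlag] k|hres].
  have [xk pk ak] := hlag k.
  have dk : dual_step f A Gamma (a k) (p k) (p k.+1).
    by rewrite pk; exact: x_update_dual_step.
  have gk : primal_step g Omega (a k) (p k) (p k.+1) (a k.+1) by exact/proxP.
  apply/seteqP; split=> [w|_ ->]; last exact/step.
  have [_ Qu] := sqrtmx_unit (posdef_metric hGamma hOmegaGamma).
  (* As the root of the metric is invertible, every candidate [w] has the form required by
     [resolventP]. *)
  rewrite -(mulKVmx Qu w) -(vsubmxK (invmx _ *m w)) !hv.
  move: (usubmx _) (dsubmx _) => a' p' /resolventP[]// a'k p'k.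
  (* [p'] is identified first, because the primal step depends on it. *)
  have pE := dual_step_unique hGamma p'k dk; rewrite {}pE in a'k *.
  by rewrite (primal_step_unique hOmega a'k gk).
have stepk k : primal_step g Omega (a k) (p k) (p k.+1) (a k.+1)
    /\ dual_step f A Gamma (a k) (p k) (p k.+1).
  by apply/step; rewrite hres.
have [xs xsP] := choice hx.
(* The shift by [predn] makes the iterate of index [k.+1] the minimizer [xs k] for (a k, p k). *)
exists (xs \o predn) => k; have [gk dk] := stepk k.
split=> //; last exact/proxP.
exact: (dual_step_unique hGamma dk (x_update_dual_step hf hGamma (xsP k))).
Qed.
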